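(* Let $\mathrm{Domb}(n)=\sum_{k=0}^{n}\binom{n}{k}^2\binom{2k}{k}\binom{2(n-k)}{n-k}$, and let $p$ be a prime with $p\equiv1\pmod 3$. Then \[\sum_{n=2}^{p-1}\frac{(n+1)^2}{n(n-1)}\cdot\frac{\mathrm{Domb}(n)}{16^n}\equiv\frac{3}{2}\pmod{p^2}.\]
   Context: A congruence between rational numbers whose denominators are coprime to $p$ is understood in the ring of rationals with denominators prime to $p$ ($p$-adic integers): $x\equiv y\pmod{p^2}$ means $(x-y)/p^2$ has denominator coprime to $p$. *)

(* Defs.v *)
From mathcomp Require Import all_boot all_order all_algebra.
Set Implicit Arguments. Unset Strict Implicit. Unset Printing Implicit Defensive.
Import Order.TTheory GRing.Theory Num.Theory.
Local Open Scope ring_scope.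

Definition Domb (n : nat) : nat :=
  (\sum_(0 <= k < n.+1) 'C(n, k) ^ 2 * 'C(2 * k, k) * 'C(2 * (n - k), n - k))%N.

(* Congruence of rationals modulo m (in the ring of rationals whose
   denominators are coprime to p): x == y (mod m) iff (x - y)/m has
   denominator coprime to p.  Here m = p^2. *)
Definition rat_cong_mod_p2 (p : nat) (x y : rat) : Prop :=
  coprime p `|denq ((x - y) / (p ^ 2)%:R)|%N.

(* Main.v *)
(** Write u(n) = Domb(n)/16^n. The three-term recurrence of u, multiplied by 1/(n-1)
and summed, shows that sum (n+1)^2/(n(n-1)) u(n) equals 3/2 plus half of
sum_(n<p) (3n+1) u(n), up to boundary terms p^3 u(p)/(p-1) and p^2 u(p-1).
By the Chan-Zudilin transformation (both sides satisfy the same recurrence),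
u(n) = sum_k C(n,k) C(n+2k,2k) C(2k,k)^2/(-16)^k, and the inner sum over n of
(3n+1) times the summand is hypergeometric: one gets
sum_(n<p) (3n+1) u(n) = p (3p-1) sum_(k<p) y(k)/(3k+2) with
y(k) = C(p-1,k) C(p+2k,2k) C(2k,k)^2/(-16)^k. It remains to see that the last sum
is divisible by p. For k > m = (p-1)/2 the factor C(2k,k)^2 supplies p^2 against at
most one p in 3k+2. For k <= m one has y(k) = (-1)^k C(m,k) C(m+k,k) mod p and
3k+2 = 3(k+i) mod p with i = (p+2)/3 <= m, so C(m+k,k)/(k+i) is a polynomial of
degree m-1 in k and its m-th finite difference vanishes. *)

Require Import Defs.
From mathcomp Require Import all_boot all_order all_algebra.
From mathcomp Require Import ring lra zify.
Import Order.TTheory GRing.Theory Num.Theory.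
Local Open Scope ring_scope.

(** * Binomial identities over the rationals, in division-free form *)

Lemma natr_bin_down (n k : nat) :
  (n.+1%:R - k%:R) * 'C(n.+1, k)%:R = n.+1%:R * 'C(n, k)%:R :> rat.
Proof.
have [kn|nk] := leqP k n.+1.
  by rewrite -natrB // -!natrM mul_bin_down.
by rewrite !bin_small ?mulr0 // ltnW.
Qed.

Lemma natr_bin_left (n k : nat) :
  k.+1%:R * 'C(n, k.+1)%:R = (n%:R - k%:R) * 'C(n, k)%:R :> rat.
Proof.
have [kn|nk] := leqP k n.
  by rewrite -natrB // -!natrM mul_bin_left.
by rewrite !bin_small ?mulr0 // ltnW.
Qed.

Lemma natr_bin_diag (n k : nat) :
  k.+1%:R * 'C(n.+1, k.+1)%:R = n.+1%:R * 'C(n, k)%:R :> rat.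
Proof. by rewrite -!natrM mul_bin_diag. Qed.

Lemma natr_central_binS (k : nat) :
  k.+1%:R * 'C(2 * k.+1, k.+1)%:R
  = 2 * (2 * k%:R + 1) * 'C(2 * k, k)%:R :> rat.
Proof.
have h1 := natr_bin_diag (2 * k).+1 k; have h2 := natr_bin_down (2 * k) k.
have -> : (2 * k.+1 = (2 * k).+2)%N by lia.
rewrite h1; have k0 : k.+1%:R != 0 :> rat by rewrite pnatr_eq0.
have -> : 'C((2 * k).+1, k)%:R = (2 * k).+1%:R * 'C(2 * k, k)%:R / k.+1%:R :> rat.
  by rewrite -h2; field; rewrite nat1r.
by field; rewrite nat1r.
Qed.

Lemma eq_divr_mul (a b x y : rat) : a != 0 -> a * x = b * y -> x = b / a * y.
Proof. by move=> a0 h; rewrite mulrAC -h mulrC mulKf. Qed.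

Lemma double_sub1_neq0 (n k : nat) : 2 * (n%:R - k%:R) - 1 != 0 :> rat.
Proof.
rewrite subr_eq0; apply/eqP => h.
have : (2 * n)%:R = (2 * k + 1)%:R :> rat 
    by transitivity (2 * (n%:R - k%:R) + 2 * k%:R : rat); [ring | rewrite h; ring].
by move/eqP; rewrite eqr_nat; lia.
Qed.

(** * Recurrence of the Domb numbers by creative telescoping *)

(* The recurrence of Domb(n)/16^n. *)
Definition dombRec (u : nat -> rat) (n : nat) : rat :=
  n.+2%:R ^+ 3 * u n.+2
  - (2 * n%:R + 3) * (5 * n%:R ^+ 2 + 15 * n%:R + 12) / 8 * u n.+1
  + n.+1%:R ^+ 3 / 4 * u n.

(** The leading coefficient [(n+2)^3] never vanishes, so two initial values determine a solution. *)
Lemma dombRec_unique (u v : nat -> rat) :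
  (forall n, dombRec u n = 0) -> (forall n, dombRec v n = 0) ->
  u 0 = v 0 -> u 1 = v 1 -> u =1 v.
Proof.
move=> hu hv h0 h1 n.
suff [] : u n = v n /\ u n.+1 = v n.+1 by [].
elim: n => [//|n [IH IH1]]; split=> //.
have e : dombRec u n = dombRec v n by rewrite hu hv.
apply: (@mulfI _ (n.+2%:R ^+ 3)); first by rewrite expf_neq0 // pnatr_eq0.
move: e; rewrite /dombRec IH IH1; lra.
Qed.

(** Since [C(n,k)^2 / n!^2 = 1 / (k!^2 (n-k)!^2)], the Domb summand splits into a function of [k]
    times the same function of [n - k]. *)
Definition gterm (m : nat) : rat := 'C(2 * m, m)%:R / m`!%:R ^+ 2.

Lemma gtermS (m : nat) :
  m.+1%:R ^+ 3 * gterm m.+1 = 2 * (2 * m%:R + 1) * gterm m.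
Proof.
have f0 : m`!%:R != 0 :> rat by rewrite pnatr_eq0 -lt0n fact_gt0.
have m0 : m.+1%:R != 0 :> rat by rewrite pnatr_eq0.
rewrite /gterm factS natrM.
transitivity (m.+1%:R * 'C(2 * m.+1, m.+1)%:R / m`!%:R ^+ 2 : rat).
  by field; rewrite nat1r f0.
by rewrite natr_central_binS; field.
Qed.

(* Domb(n)/n!^2 is the convolution square of gterm; extending the summand by 0 to
   k > n lets the sums at n, n+1 and n+2 share one range. *)
Definition conv_term (n k : nat) : rat :=
  if (k <= n)%N then gterm k * gterm (n - k) else 0.

(** Stated without division so that it survives at the edge [k = n+1], where [conv_term n k] and the
    cubed factor both vanish. *)
Lemma conv_termSn (n k : nat) :
  2 * (2 * (n%:R - k%:R) + 1) * conv_term n k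
  = (n.+1%:R - k%:R) ^+ 3 * conv_term n.+1 k.
Proof.
rewrite /conv_term; have [kn|nk|->] := ltngtP k n.+1.
- rewrite -ltnS kn subSn // -(natrB _ (ltnW kn)) subSn //.
  by rewrite [RHS]mulrCA gtermS natrB //; ring.
- by rewrite leqNgt ltnW // !mulr0.
- by rewrite ltnn subrr expr0n /= mul0r mulr0.
Qed.

Lemma conv_termSk (n k : nat) :
  k.+1%:R ^+ 3 * (2 * (n%:R - k%:R) - 1) * conv_term n k.+1
  = (2 * k%:R + 1) * (n%:R - k%:R) ^+ 3 * conv_term n k.
Proof.
rewrite /conv_term; have [kn|nk|->] := ltngtP k n.
- have e := gtermS (n - k.+1); move: e.
  rewrite -subSn // subSS natrB ?(ltnW kn) // natrB // => e.
  transitivity ((2 * (n%:R - k%:R) - 1) * gterm (n - k.+1) * (k.+1%:R ^+ 3 * gterm k.+1)).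
    ring.
  rewrite gtermS.
  transitivity ((2 * k%:R + 1) * gterm k * (2 * (2 * (n%:R - k.+1%:R) + 1) * gterm (n - k.+1))).
    ring.
  by rewrite -e; ring.
- by rewrite !mulr0.
- by rewrite subrr expr0n /= !mulr0 mul0r.
Qed.

(* Zeilberger certificate, found by undetermined coefficients; 2(n-k)-1 is odd, so
   the division is never by 0. *)
Definition conv_cert (n k : nat) : rat :=
  k%:R ^+ 3 / (2 * (n%:R - k%:R) - 1) *
  (4 * k%:R ^+ 3 + (6 - 18 * n%:R) * k%:R ^+ 2 + (26 * n%:R ^+ 2 - 15 * n%:R) * k%:R
   - 12 * n%:R ^+ 3 + 10 * n%:R ^+ 2) * conv_term n k.

(** Every term is a rational multiple of [conv_term n.+2 k], which leaves an identity of rational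
    functions in [n] and [k]. *)
Lemma conv_cert_telescope (n k : nat) :
  n.+2%:R ^+ 5 * conv_term n.+2 k
  - 2 * (2 * n%:R + 3) * (5 * n%:R ^+ 2 + 15 * n%:R + 12) * conv_term n.+1 k
  + 64 * n.+1%:R * conv_term n k
  = conv_cert n.+2 k.+1 - conv_cert n.+2 k.
Proof.
have a1 := double_sub1_neq0 n.+1 k; have a2 := double_sub1_neq0 n.+2 k.
have e1 : conv_term n.+1 k
  = (n.+2%:R - k%:R) ^+ 3 / (2 * (2 * (n.+2%:R - k%:R) - 1)) * conv_term n.+2 k.
  by apply: eq_divr_mul; [rewrite mulf_neq0 | rewrite -conv_termSn; ring].
have e0 : conv_term n k
  = (n.+1%:R - k%:R) ^+ 3 / (2 * (2 * (n.+1%:R - k%:R) - 1)) * conv_term n.+1 k.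
  by apply: eq_divr_mul; [rewrite mulf_neq0 | rewrite -conv_termSn; ring].
have k0 : k.+1%:R != 0 :> rat by rewrite pnatr_eq0.
have e2 : conv_term n.+2 k.+1 = (2 * k%:R + 1) * (n.+2%:R - k%:R) ^+ 3
    / (k.+1%:R ^+ 3 * (2 * (n.+2%:R - k%:R) - 1)) * conv_term n.+2 k.
  by apply: eq_divr_mul (conv_termSk _ _); rewrite mulf_neq0 // expf_neq0.
have a3 : 2 * (n.+2%:R - k.+1%:R) - 1 != 0 :> rat.
  by apply: contra_neq a1 => <-; ring.
rewrite /conv_cert e0 e1 e2; field.
by apply/and3P; split; [apply: contra_neq a2 => <-; ring | rewrite nat1r
  | apply: contra_neq a3 => <-; ring].
Qed.

Definition scaled_Domb (n : nat) : rat := (Domb n)%:R / 16%:R ^+ n.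

Lemma sum_conv_term (n N : nat) : (n < N)%N ->
  \sum_(k < N) conv_term n k = (Domb n)%:R / n`!%:R ^+ 2.
Proof.
move=> nN; rewrite -(big_mkord xpredT (conv_term n)) (big_cat_nat _ nN) //=.
rewrite [X in _ + X]big_nat_cond [X in _ + X]big1 ?addr0; last first.
  by move=> k /andP [/andP [nk _] _]; rewrite /conv_term leqNgt nk.
have f0 m : m`!%:R != 0 :> rat by rewrite pnatr_eq0 -lt0n fact_gt0.
rewrite /Domb natr_sum mulr_suml; apply: eq_big_nat => k /andP [_ kn].
rewrite ltnS in kn; rewrite /conv_term kn /gterm !natrM.
have := congr1 (fun m => m%:R : rat) (bin_fact kn); rewrite /= !natrM => <-.
by field; rewrite !f0 /= pnatr_eq0 -lt0n bin_gt0.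
Qed.

Lemma scaled_Domb_rec (n : nat) : dombRec scaled_Domb n = 0.
Proof.
pose h i := \sum_(k < n.+3) conv_term i k.
have hE i : (i < n.+3)%N -> scaled_Domb i = i`!%:R ^+ 2 * h i / 16%:R ^+ i.
  move=> i3; rewrite /h sum_conv_term // mulrCA mulfV ?mulr1 //.
  by rewrite expf_neq0 // pnatr_eq0 -lt0n fact_gt0.
have e : n.+2%:R ^+ 5 * h n.+2
  - 2 * (2 * n%:R + 3) * (5 * n%:R ^+ 2 + 15 * n%:R + 12) * h n.+1
  + 64 * n.+1%:R * h n = 0.
  rewrite !mulr_sumr -sumrB -big_split /=.
  under eq_bigr do rewrite conv_cert_telescope.
  rewrite -(big_mkord xpredT (fun k => conv_cert n.+2 k.+1 - conv_cert n.+2 k)).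
  (* The certificate vanishes at [k = n+3] by the support of [conv_term], and at [k = 0] by the
     factor [k^3]. *)
  rewrite telescope_sumr // /conv_cert /conv_term ltnn mulr0.
  by rewrite expr0n /= !mul0r subrr.
rewrite /dombRec !hE; try lia.
rewrite !factS !natrM !exprS.
have p0 : 16%:R ^+ n != 0 :> rat by rewrite expf_neq0.
(* The prefactor undoes the normalisation by [n!^2] and [16^n]. *)
transitivity (n`!%:R ^+ 2 * n.+1%:R ^+ 2 / (256 * 16%:R ^+ n) * (n.+2%:R ^+ 5 * h n.+2
  - 2 * (2 * n%:R + 3) * (5 * n%:R ^+ 2 + 15 * n%:R + 12) * h n.+1
  + 64 * n.+1%:R * h n)); last by rewrite e mulr0.
by field.
Qed.

(** * The Chan-Zudilin transformation *)

(* Summand of the Chan-Zudilin transformation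
   Domb(n) = sum_k C(n,k) C(n+2k,2k) C(2k,k)^2 (-1)^k 16^(n-k). *)
Definition cz_term (n k : nat) : rat :=
  'C(n, k)%:R * 'C(n + 2 * k, 2 * k)%:R * 'C(2 * k, k)%:R ^+ 2 / (- 16%:R) ^+ k.

Lemma cz_termSn (n k : nat) :
  (n%:R + 2 * k%:R + 1) * cz_term n k = (n.+1%:R - k%:R) * cz_term n.+1 k.
Proof.
have h1 := natr_bin_down n k; have h2 := natr_bin_down (n + 2 * k) (2 * k).
have n0 : n.+1%:R != 0 :> rat by rewrite pnatr_eq0.
apply: (mulfI n0); rewrite /cz_term addSn.
transitivity ((n + 2 * k).+1%:R * 'C(n + 2 * k, 2 * k)%:R * (n.+1%:R * 'C(n, k)%:R) *
  'C(2 * k, k)%:R ^+ 2 / (- 16%:R) ^+ k : rat); first by ring.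
by rewrite -h1 -h2; ring.
Qed.

Lemma cz_termSk (n k : nat) :
  8 * k.+1%:R ^+ 4 * cz_term n k.+1
  = - ((n%:R + 2 * k%:R + 1) * (n%:R + 2 * k%:R + 2) * (n%:R - k%:R) * (2 * k%:R + 1)) * cz_term n k.
Proof.
have h1 := natr_bin_left n k; have h2 := natr_bin_diag (n + 2 * k) (2 * k).
have h3 := natr_bin_diag (n + 2 * k).+1 (2 * k).+1.
have h4 := natr_central_binS k.
have k1 : (2 * k).+1%:R != 0 :> rat by rewrite pnatr_eq0.
apply: (mulfI k1); rewrite /cz_term.
have -> : (n + 2 * k.+1 = (n + 2 * k).+2)%N by lia.
rewrite [(- 16%:R) ^+ k.+1]exprS invfM.
transitivity (- (2 * k).+1%:R / 4 * (k.+1%:R * 'C(n, k.+1)%:R)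
  * ((2 * k).+2%:R * 'C((n + 2 * k).+2, (2 * k).+2)%:R)
  * (k.+1%:R * 'C(2 * k.+1, k.+1)%:R) ^+ 2 / (- 16%:R) ^+ k : rat).
  have -> : ((2 * k.+1) = (2 * k).+2)%N by lia.
  by field; rewrite expf_neq0 // oppr_eq0.
rewrite h1 h3 h4.
transitivity (- 1 / 4 * ((n%:R - k%:R) * 'C(n, k)%:R) * (n + 2 * k).+2%:R
  * ((2 * k).+1%:R * 'C((n + 2 * k).+1, (2 * k).+1)%:R)
  * (2 * (2 * k%:R + 1) * 'C(2 * k, k)%:R) ^+ 2 / (- 16%:R) ^+ k : rat).
  by ring.
rewrite h2.
by field; rewrite expf_neq0 // oppr_eq0.
Qed.

Lemma cz_term_small (n k : nat) : (n < k)%N -> cz_term n k = 0.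
Proof. by move=> nk; rewrite /cz_term bin_small // !mul0r. Qed.

(* The recurrence uses n >= 2, where the denominator is positive. *)
Definition cz_cert (n k : nat) : rat :=
  k%:R ^+ 4 * (3 - 9 * n%:R) / ((n%:R + 2 * k%:R) * (n%:R + 2 * k%:R - 1)) * cz_term n k.

Lemma cz_cert_telescope (n k : nat) :
  dombRec (cz_term^~ k) n = cz_cert n.+2 k.+1 - cz_cert n.+2 k.
Proof.
have n1 : n%:R + 2 * k%:R + 1 != 0 :> rat.
  by rewrite -natrM -natrD natr1 pnatr_eq0.
have n2 : n.+1%:R + 2 * k%:R + 1 != 0 :> rat.
  by rewrite -natrM -natrD natr1 pnatr_eq0.
have e0 := eq_divr_mul _ _ _ _ n1 (cz_termSn n k).
have e1 := eq_divr_mul _ _ _ _ n2 (cz_termSn n.+1 k).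
have k0 : k.+1%:R != 0 :> rat by rewrite pnatr_eq0.
have k8 : 8 * k.+1%:R ^+ 4 != 0 :> rat by rewrite mulf_neq0 // expf_neq0.
have e2 := eq_divr_mul _ _ _ _ k8 (cz_termSk n.+2 k).
have hn := ler0n rat n; have hk := ler0n rat k.
by rewrite /dombRec /cz_cert e0 e1 e2; field; apply/and5P; split; apply: lt0r_neq0; lra.
Qed.

Definition cz_sum (n : nat) : rat := \sum_(k < n.+1) cz_term n k.

Lemma sum_cz_term (n N : nat) : (n < N)%N -> \sum_(k < N) cz_term n k = cz_sum n.
Proof.
move=> nN; rewrite /cz_sum -(big_mkord xpredT (cz_term n)) (big_cat_nat _ nN) //= big_mkord.
rewrite [X in _ + X]big_nat_cond [X in _ + X]big1 ?addr0 // => k /andP [/andP [nk _] _].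
exact: cz_term_small.
Qed.

Lemma cz_sum_rec (n : nat) : dombRec cz_sum n = 0.
Proof.
have vE i : (i < n.+3)%N -> cz_sum i = \sum_(k < n.+3) cz_term i k by move/sum_cz_term.
rewrite /dombRec !vE; try lia.
rewrite !mulr_sumr -sumrB -big_split /=.
under eq_bigr => k _ do rewrite -/(dombRec (cz_term^~ k) n) cz_cert_telescope.
rewrite -(big_mkord xpredT (fun k => cz_cert n.+2 k.+1 - cz_cert n.+2 k)).
rewrite telescope_sumr // /cz_cert cz_term_small // mulr0.
by rewrite expr0n /= !mul0r subrr.
Qed.

Lemma scaled_DombE (n : nat) : scaled_Domb n = cz_sum n.
Proof.
apply: dombRec_unique; [exact: scaled_Domb_rec | exact: cz_sum_rec | |].
  by rewrite /scaled_Domb /cz_sum /Domb /cz_term big_nat1 big_ord1.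
(* At [n = 1] both sides equal [1/4]. *)
rewrite /scaled_Domb /cz_sum /Domb /cz_term !big_ord_recr big_ord0 /= !big_nat_recr //= big_nil.
by apply/eqP; vm_compute.
Qed.

(** * Summation over [n] in closed form *)

(** Induction on [N]: the recurrence at [N+1] trades [u(N+3)] for [u(N+2)] and [u(N+1)]. It will be
    used with [N + 2 = p], which puts [p^3] and [p^2] in the boundary terms. *)
Lemma weighted_sum_telescope (N : nat) :
  \sum_(2 <= n < N.+2) ((n.+1)%:R ^+ 2 / (n%:R * (n.-1)%:R)) * scaled_Domb n
  = 2^-1 * (\sum_(n < N.+2) (3 * n%:R + 1) * scaled_Domb n) + 3%:R / 2%:R
    - 4 * N.+2%:R ^+ 3 / N.+1%:R * scaled_Domb N.+2 + N.+2%:R ^+ 2 * scaled_Domb N.+1.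
Proof.
elim: N => [|N IH].
  rewrite big_geq // !big_ord_recr big_ord0 /= /scaled_Domb /Domb !big_nat_recr //= !big_nil.
  by apply/eqP; vm_compute.
rewrite big_nat_recr // IH [in RHS]big_ord_recr /=.
have h : N.+3%:R ^+ 3 * scaled_Domb N.+3
  = (2 * N.+1%:R + 3) * (5 * N.+1%:R ^+ 2 + 15 * N.+1%:R + 12) / 8 * scaled_Domb N.+2
  - N.+2%:R ^+ 3 / 4 * scaled_Domb N.+1.
  by have := scaled_Domb_rec N.+1; rewrite /dombRec => h; lra.
have n1 : N.+1%:R != 0 :> rat by rewrite pnatr_eq0.
have n2 : N.+2%:R != 0 :> rat by rewrite pnatr_eq0.
transitivity (2^-1 * (\sum_(i < N.+2) (3 * i%:R + 1) * scaled_Domb i + (3 * N.+2%:R + 1) * scaled_Domb N.+2)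
   + 3 / 2 - 4 / N.+2%:R * (N.+3%:R ^+ 3 * scaled_Domb N.+3) + N.+3%:R ^+ 2 * scaled_Domb N.+2); last by ring.
by rewrite h; field; rewrite nat1r -(natrD _ 2 N) n1 n2.
Qed.

(** Gosper summation in [n]. The induction step rests on [(3N-1)(N-k) + (3N+1)(3k+2) =
    (3N+2)(N+2k+1)]. *)
Lemma sum_linear_cz_term (N k : nat) :
  \sum_(n < N) (3 * n%:R + 1) * cz_term n k
  = (3 * N%:R - 1) * (N%:R - k%:R) / (3 * k%:R + 2) * cz_term N k.
Proof.
have k2 : 3 * k%:R + 2 != 0 :> rat by rewrite -natrM -natrD pnatr_eq0 addn2.
elim: N => [|N IH].
  rewrite big_ord0; case: k {k2} => [|k]; first by rewrite subrr mulr0 !mul0r.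
  by rewrite cz_term_small // mulr0.
rewrite big_ord_recr /= IH.
transitivity ((3 * N%:R + 2) / (3 * k%:R + 2) * ((N%:R + 2 * k%:R + 1) * cz_term N k)).
  by field.
by rewrite cz_termSn; field.
Qed.

(** * Divisibility by powers of [p] among [p]-integral rationals *)

(* p^e divides x in the ring of rationals with denominator prime to p. *)
Definition pdvd (p e : nat) (x : rat) : Prop :=
  exists a : int, exists2 b : nat, coprime p b & x * b%:R = a%:~R * p%:R ^+ e.

Lemma pdvd0 (p e : nat) : pdvd p e 0.
Proof. by exists 0, 1%N; rewrite ?coprimen1 // !mul0r. Qed.

Lemma pdvdD (p e : nat) (x y : rat) : pdvd p e x -> pdvd p e y -> pdvd p e (x + y).
Proof.
move=> [a [b cb xE]] [c [d cd yE]].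
exists (a * d%:Z + c * b%:Z), (b * d)%N; first by rewrite coprimeMr cb.
rewrite natrM rmorphD !rmorphM /= -!pmulrn.
transitivity (x * b%:R * d%:R + y * d%:R * b%:R : rat); first by ring.
by rewrite xE yE; ring.
Qed.

Lemma pdvdM (p e f : nat) (x y : rat) :
  pdvd p e x -> pdvd p f y -> pdvd p (e + f) (x * y).
Proof.
move=> [a [b cb xE]] [c [d cd yE]].
exists (a * c), (b * d)%N; first by rewrite coprimeMr cb.
by rewrite natrM mulrACA xE yE rmorphM exprD mulrACA.
Qed.

(** Exponent 0 expresses [p]-integrality, so this is the ideal property. *)
Lemma pdvdMl (p e : nat) (x y : rat) : pdvd p 0 x -> pdvd p e y -> pdvd p e (x * y).
Proof. exact: pdvdM. Qed.

Lemma pdvd_intr (p : nat) (a : int) : pdvd p 0 a%:~R.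
Proof. by exists a, 1%N; rewrite ?coprimen1 // !mulr1. Qed.

Lemma pdvd_natr (p n : nat) : pdvd p 0 n%:R.
Proof. by rewrite pmulrn; exact: pdvd_intr. Qed.

Lemma pdvdN (p e : nat) (x : rat) : pdvd p e x -> pdvd p e (- x).
Proof. by move=> h; rewrite -mulN1r; apply: pdvdMl h; exact: (pdvd_intr p (-1)). Qed.

Lemma pdvdB (p e : nat) (x y : rat) : pdvd p e x -> pdvd p e y -> pdvd p e (x - y).
Proof. by move=> hx hy; apply: pdvdD hx (pdvdN _ _ _ hy). Qed.

Lemma pdvd_sum (p e : nat) (I : Type) (r : seq I) (P : pred I) (f : I -> rat) :
  (forall i, P i -> pdvd p e (f i)) -> pdvd p e (\sum_(i <- r | P i) f i).
Proof. by move=> h; apply: big_ind h; [exact: pdvd0 | exact: pdvdD]. Qed.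

Lemma pdvdX (p e : nat) : pdvd p e (p%:R ^+ e).
Proof. by exists 1, 1%N; rewrite ?coprimen1 // mulr1 mul1r. Qed.

Lemma pdvdW (p e f : nat) (x : rat) : (e <= f)%N -> pdvd p f x -> pdvd p e x.
Proof.
move=> ef [a [b cb xE]]; exists (a * p%:Z ^+ (f - e)), b => //.
by rewrite xE rmorphM rmorphXn /= -mulrA -exprD subnK.
Qed.

Lemma pdvd_expr (p n : nat) (x : rat) : pdvd p 0 x -> pdvd p 0 (x ^+ n).
Proof.
move=> hx; elim: n => [|n IH]; first exact: (pdvd_natr p 1).
by rewrite exprS; apply: pdvdMl.
Qed.

Ltac pdvd_integral := repeat first
  [ exact: pdvd_natr | exact: (pdvd_natr _ 1) | assumption
  | apply: pdvdMl | apply: pdvdB | apply: pdvdD | apply: pdvdN | apply: pdvd_expr ].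

Lemma pdvd_cancel (p e b : nat) (x : rat) :
  coprime p b -> pdvd p e (b%:R * x) -> pdvd p e x.
Proof.
move=> cb [a [d cd xE]]; exists a, (b * d)%N; first by rewrite coprimeMr cb.
by rewrite -xE natrM; ring.
Qed.

Lemma pdvd_divr (p e b : nat) (x : rat) :
  prime p -> coprime p b -> pdvd p e x -> pdvd p e (x / b%:R).
Proof.
move=> pp cb h; apply: (pdvd_cancel _ _ _ _ cb).
rewrite mulrC divfK // pnatr_eq0; apply/eqP => b0.
by move: cb; rewrite b0 /coprime gcdn0 => /eqP p1; rewrite p1 in pp.
Qed.

(** The reduced denominator of the quotient divides any denominator [b] that represents it, by
    Gauss's lemma. *)
Lemma pdvd_coprime_denq (p e : nat) (x : rat) :
  prime p -> pdvd p e x -> coprime p `|denq (x / (p ^ e)%:R)|%N.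
Proof.
move=> pp [a [b cb xE]]; set q := x / _.
have p0 : p%:R != 0 :> rat by rewrite pnatr_eq0 -lt0n prime_gt0.
have qb : q * b%:R = a%:~R.
  by rewrite /q natrX mulrAC xE mulfK // expf_neq0.
have e1 : numq q * b%:Z = a * denq q.
  apply/eqP; rewrite -(eqr_int rat) !rmorphM /= -qb -pmulrn numqE; apply/eqP; ring.
have : (denq q %| b%:Z)%Z.
  rewrite -(@Gauss_dvdzr _ (numq q)); first by rewrite e1 dvdz_mull.
  by rewrite coprimezE coprime_sym coprime_num_den.
rewrite dvdzE /= => hd.
exact: coprime_dvdr hd cb.
Qed.

(** * Factorials, central binomials and finite differences *)

Lemma prime_coprime_fact (p k : nat) : prime p -> (k < p)%N -> coprime p k`!.
Proof.
move=> pp; elim: k => [|k IH] kp; first by rewrite coprimen1.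
rewrite factS coprimeMr IH ?andbT; last exact: ltnW.
by rewrite prime_coprime // gtnNdvd.
Qed.

(** [p] divides [(2k)!] but not [k!^2]. *)
Lemma prime_dvd_central_bin (p k : nat) :
  prime p -> (k < p <= 2 * k)%N -> (p %| 'C(2 * k, k))%N.
Proof.
move=> pp /andP [kp pk].
have ck := prime_coprime_fact _ _ pp kp.
have : (p %| (2 * k)`!)%N by rewrite dvdn_fact // prime_gt0.
rewrite -(@bin_fact (2 * k) k); last by lia.
have -> : (2 * k - k = k)%N by lia.
by rewrite Gauss_dvdl // coprimeMr ck.
Qed.

(** An [m]-th finite difference kills polynomials of degree below [m]. Induction on the degree: in a
    factor [k + l], the part [l] lowers the degree, and the part [k] is absorbed by
    [k C(m+1,k) = (m+1) C(m,k-1)]; shifting [k] then adds 1 to each entry of [s]. *)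
Lemma alternating_bin_prod (s : seq nat) (m : nat) : (size s < m)%N ->
  \sum_(k < m.+1) (-1) ^+ k * 'C(m, k)%:R * \prod_(l <- s) (k + l)%:R = 0 :> rat.
Proof.
move: {2}(size s) (erefl (size s)) => n; elim: n s m => [|n IH] s m.
  move/size0nil => -> /= m0.
  transitivity ((1 - 1) ^+ m : rat); last by rewrite subrr expr0n; case: m m0.
  rewrite exprBn; apply: eq_bigr => k _.
  by rewrite big_nil !expr1n !mulr1 mulr_natr.
case: s => // l s [sn]; case: m => // m /=; rewrite ltnS => sm.
under eq_bigr => k _ do rewrite big_cons natrD mulrA mulrDr mulrDl.
rewrite big_split /= [X in _ + X](_ : _ = 0) ?addr0; last first.
  transitivity (l%:R * \sum_(k < m.+2) (-1) ^+ k * 'C(m.+1, k)%:R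
                     * \prod_(l <- s) (k + l)%:R : rat).
    by rewrite mulr_sumr; apply: eq_bigr => k _; ring.
  by rewrite IH ?mulr0 // ltnS ltnW.
rewrite big_ord_recl /= mulr0 mul0r add0r.
transitivity (- m.+1%:R * \sum_(k < m.+1) (-1) ^+ k * 'C(m, k)%:R
                     * \prod_(l <- map succn s) (k + l)%:R : rat).
  rewrite mulr_sumr; apply: eq_bigr => k _.
  rewrite big_map /bump /= add1n.
  under [in RHS]eq_bigr => i _ do rewrite addnS -addSn.
  have e := natr_bin_diag m k.
  transitivity (- (-1) ^+ k * (k.+1%:R * 'C(m.+1, k.+1)%:R)
                  * \prod_(j <- s) (k.+1 + j)%:R : rat); first by rewrite exprS; ring.
  by rewrite e; ring.
by rewrite IH ?mulr0 // size_map.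
Qed.

(** Exhibits [C(m+k,k)] as a polynomial in [k] split into linear factors, one of which can later be
    removed. *)
Lemma prod_iota_bin (m k : nat) :
  \prod_(l <- iota 1 m) (k + l)%:R = m`!%:R * 'C(m + k, k)%:R :> rat.
Proof.
elim: m => [|m IH]; first by rewrite big_nil add0n binn mulr1.
have -> : iota 1 m.+1 = iota 1 m ++ [:: m.+1] by rewrite -[in LHS](addn1 m) iotaD add1n.
rewrite big_cat big_seq1 /= IH addSn factS.
have e := natr_bin_down (m + k) k.
transitivity (m`!%:R * ((m + k).+1%:R * 'C(m + k, k)%:R) : rat); first by ring.
by rewrite -e; ring.
Qed.

(** * Divisibility by [p] of the boundary sum *)

(** The [y(k)] of the overview: for [k < p], it is [cz_term p k] with the factor [p / (p - k)] taken
    out. *)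
Definition cz_boundary (p k : nat) : rat :=
  'C(p.-1, k)%:R * 'C(p + 2 * k, 2 * k)%:R * 'C(2 * k, k)%:R ^+ 2 / (- 16%:R) ^+ k.

Lemma cz_boundaryE (p k : nat) : (0 < p)%N -> (p%:R - k%:R) * cz_term p k = p%:R * cz_boundary p k.
Proof.
case: p => // p _; rewrite /cz_term /cz_boundary /=; have e := natr_bin_down p k.
rewrite !mulrA e; ring.
Qed.

(** Induction on [k]; the bound [k <= m] keeps the leading coefficients of the recurrences prime to
    [p]. *)
Lemma cz_boundary_cong (p m k : nat) : prime p -> p = (2 * m).+1 -> (k <= m)%N ->
  pdvd p 1 (cz_boundary p k - (-1) ^+ k * 'C(m, k)%:R * 'C(m + k, k)%:R).
Proof.
move=> pp pm; pose w k : rat := (-1) ^+ k * 'C(m, k)%:R * 'C(m + k, k)%:R.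
rewrite -/(w k); elim: k => [|k IH] km.
  by rewrite /cz_boundary /w !muln0 !bin0 !expr0 expr1n invr1 !mul1r subrr; exact: pdvd0.
have p0 : (0 < p)%N by exact: prime_gt0.
have {}IH := IH (ltnW km).
(* Both sides satisfy first-order recurrences in k that agree modulo p. *)
have hw : 4 * k.+1%:R ^+ 2 * w k.+1 = ((2 * k%:R + 1) ^+ 2 - p%:R ^+ 2) * w k.
  rewrite /w addnS; have e1 := natr_bin_left m k; have e2 := natr_bin_diag (m + k) k.
  transitivity (- 4 * (-1) ^+ k * (k.+1%:R * 'C(m, k.+1)%:R)
                    * (k.+1%:R * 'C((m + k).+1, k.+1)%:R) : rat).
    by rewrite [(-1) ^+ k.+1]exprS; ring.
  (* For [p = 2m+1], [4 (m-k) (m+k+1) = p^2 - (2k+1)^2]. *)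
  by rewrite e1 e2 pm; ring.
have hy : 8 * k.+1%:R ^+ 4 * cz_boundary p k.+1
  = - ((p%:R - k.+1%:R) * (p%:R + 2 * k%:R + 1) * (p%:R + 2 * k%:R + 2) * (2 * k%:R + 1)) * cz_boundary p k.
  have e := cz_termSk p k.
  have p0' : p%:R != 0 :> rat by rewrite pnatr_eq0 -lt0n.
  apply: (mulfI p0').
  transitivity (8 * k.+1%:R ^+ 4 * (p%:R * cz_boundary p k.+1)); first by ring.
  rewrite -cz_boundaryE //.
  transitivity ((p%:R - k.+1%:R) * (8 * k.+1%:R ^+ 4 * cz_term p k.+1)); first by ring.
  rewrite e.
  transitivity (- ((p%:R - k.+1%:R) * (p%:R + 2 * k%:R + 1) * (p%:R + 2 * k%:R + 2) * (2 * k%:R + 1))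
     * ((p%:R - k%:R) * cz_term p k)); first by ring.
  by rewrite cz_boundaryE //; ring.
have c2 : coprime p 2 by rewrite prime_coprime // pm; apply/negP => /dvdn_leq; lia.
have ck : coprime p k.+1 by rewrite prime_coprime //; apply/negP => /dvdn_leq; lia.
apply: (@pdvd_cancel p 1 (8 * k.+1 ^ 4)).
  by rewrite coprimeMr coprimeXr // andbT (@coprimeXr 3 p 2).
have -> : (8 * k.+1 ^ 4)%:R * (cz_boundary p k.+1 - w k.+1) =
  - ((p%:R - k.+1%:R) * (p%:R + 2 * k%:R + 1) * (p%:R + 2 * k%:R + 2) * (2 * k%:R + 1)) * cz_boundary p k
  - 2 * k.+1%:R ^+ 2 * (((2 * k%:R + 1) ^+ 2 - p%:R ^+ 2) * w k).
  by rewrite natrM natrX mulrBr -hw -hy; ring.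
have wi j : pdvd p 0 (w j).
  by rewrite /w; pdvd_integral.
(* Regrouped as an integral multiple of the induction hypothesis plus an explicit multiple of
   [p]. *)
have -> : - ((p%:R - k.+1%:R) * (p%:R + 2 * k%:R + 1) * (p%:R + 2 * k%:R + 2) * (2 * k%:R + 1))
    * cz_boundary p k - 2 * k.+1%:R ^+ 2 * (((2 * k%:R + 1) ^+ 2 - p%:R ^+ 2) * w k)
  = - ((p%:R - k.+1%:R) * (p%:R + 2 * k%:R + 1) * (p%:R + 2 * k%:R + 2) * (2 * k%:R + 1))
    * (cz_boundary p k - w k)
  + (2 * k.+1%:R ^+ 2 * p%:R - (2 * k%:R + 1) * (p%:R ^+ 2 + p%:R * (2 * k%:R + 1 + k.+1%:R)
    + (2 * k%:R + 1) * k.+1%:R - 2 * k.+1%:R ^+ 2)) * w k * p%:R ^+ 1.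
  by ring.
apply: pdvdD; apply: pdvdMl; [|done| |exact: pdvdX]; pdvd_integral.
Qed.

(** The inequality [(p+2)/3 <= (p-1)/2] amounts to [p >= 7]. *)
Lemma prime_1mod3_params (p : nat) : prime p -> p = 1 %[mod 3] ->
  exists m i : nat, [/\ p = (2 * m).+1, (3 * i = p + 2)%N, (0 < i <= m)%N & (6 < p)%N].
Proof.
move=> pp p3; have p7 : (6 < p)%N.
  by case: p pp p3 => [|[|[|[|[|[|[|p]]]]]]].
have po : odd p by case: (even_prime pp) => // p2; rewrite p2 in p7.
have po2 : (p %% 2 = 1)%N by rewrite modn2 po.
exists (p %/ 2)%N, ((p + 2) %/ 3)%N; split; lia.
Qed.

Lemma sum_cz_boundary_low (p m i : nat) : prime p -> p = (2 * m).+1 -> (3 * i = p + 2)%N ->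
  (0 < i <= m)%N -> pdvd p 1 (\sum_(k < m.+1) cz_boundary p k / (3 * k%:R + 2)).
Proof.
move=> pp pm ip im.
have mi : i \in iota 1 m by rewrite mem_iota; lia.
have cm : coprime p m`! by apply: prime_coprime_fact => //; lia.
have c3 : coprime p 3 by rewrite prime_coprime //; apply/negP => /dvdn_leq; lia.
apply: (@pdvd_cancel p 1 (3 * m`!)); first by rewrite coprimeMr c3.
(* 3k+2 = 3(k+i) - p, and (k+1)...(k+m)/(k+i) is a polynomial in k of degree m-1,
   killed by the m-th finite difference. *)
pose s := rem i (iota 1 m).
have z : \sum_(k < m.+1) (-1) ^+ k * 'C(m, k)%:R * \prod_(l <- s) (k + l)%:R = 0 :> rat.
  by apply: alternating_bin_prod; rewrite size_rem // size_iota; lia.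
(* Subtracting this vanishing sum makes the divisibility hold term by term. *)
rewrite -[X in pdvd _ _ X]subr0 -[X in _ - X]z mulr_sumr -sumrB.
apply: pdvd_sum => -[k km] _ /=.
have ck : coprime p (3 * k + 2).
  (* As [3k+2 < 2p], the only multiple to exclude is [3k+2 = p], which contradicts [3i = p+2] modulo
     3. *)
  rewrite prime_coprime //; apply/negP => /dvdnP [[|[|c]]]; rewrite ?mulSn; lia.
apply: (pdvd_cancel _ _ _ _ ck).
have k0 : 3 * k%:R + 2 != 0 :> rat by rewrite -natrM -natrD pnatr_eq0 addn2.
have -> : (3 * k + 2)%:R * ((3 * m`!)%:R * (cz_boundary p k / (3 * k%:R + 2))
   - (-1) ^+ k * 'C(m, k)%:R * \prod_(l <- s) (k + l)%:R)
  = 3 * m`!%:R * (cz_boundary p k - (-1) ^+ k * 'C(m, k)%:R * 'C(m + k, k)%:R)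
  + (-1) ^+ k * 'C(m, k)%:R * \prod_(l <- s) (k + l)%:R * p%:R ^+ 1.
  have e := prod_iota_bin m k; rewrite (big_rem _ mi) /= -/s in e.
  have -> : p%:R = 3 * i%:R - 2 :> rat by rewrite -natrM ip natrD addrK.
  transitivity (3 * m`!%:R * cz_boundary p k - (-1) ^+ k * 'C(m, k)%:R * 3 * (m`!%:R * 'C(m + k, k)%:R)
     + (-1) ^+ k * 'C(m, k)%:R * \prod_(l <- s) (k + l)%:R * (3 * i%:R - 2)); last by ring.
  rewrite -e; field; done.
apply: pdvdD; apply: pdvdMl.
- by pdvd_integral.
- by apply: cz_boundary_cong.
- have h : pdvd p 0 (\prod_(l <- s) (k + l)%:R).
    by rewrite -natr_prod; exact: pdvd_natr.
  by pdvd_integral.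
- exact: pdvdX.
Qed.

Lemma cz_boundary_high (p k : nat) : prime p -> (2 < p)%N -> (k < p <= 2 * k)%N ->
  pdvd p 1 (cz_boundary p k / (3 * k%:R + 2)).
Proof.
move=> pp p2 kp; have /dvdnP [c cE] := prime_dvd_central_bin _ _ pp kp.
have p0 : p%:R != 0 :> rat by rewrite pnatr_eq0; lia.
have c2 : coprime p 2 by rewrite prime_coprime //; apply/negP => /dvdn_leq; lia.
have i16 : pdvd p 0 (((- 16%:R) ^+ k)^-1).
  rewrite -exprVn; apply: pdvd_expr; rewrite invrN; apply: pdvdN.
  rewrite -[_^-1]mul1r; apply: pdvd_divr => //; last exact: (pdvd_natr p 1).
  exact: (@coprimeXr 4 p 2).
have hq : pdvd p 1 (p%:R ^+ 2 / (3 * k%:R + 2)).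
  have -> : 3 * k%:R + 2 = (3 * k + 2)%:R :> rat by rewrite natrD natrM.
  have [/dvdnP [t tE]|nd] := boolP (p %| 3 * k + 2)%N; last first.
    apply: pdvd_divr => //; first by rewrite prime_coprime.
    by apply: (@pdvdW p 1 2) => //; exact: pdvdX.
  (* [k < p] gives [3k+2 < 3p]; hence [t] is 1 or 2, prime to [p], and only one factor [p] is
     lost. *)
  have ht : (0 < t < 3)%N.
    by case: t tE => [|[|[|t]]]; rewrite ?mulSn; lia.
  have t0 : t%:R != 0 :> rat by rewrite pnatr_eq0; lia.
  have -> : p%:R ^+ 2 / (3 * k + 2)%:R = p%:R ^+ 1 / t%:R :> rat.
    by rewrite tE natrM; field; rewrite t0 p0.
  apply: pdvd_divr (pdvdX _ _) => //.
  by rewrite prime_coprime //; apply/negP => /dvdn_leq; lia.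
have -> : cz_boundary p k / (3 * k%:R + 2) = 'C(p.-1, k)%:R * 'C(p + 2 * k, 2 * k)%:R * c%:R ^+ 2
   * ((- 16%:R) ^+ k)^-1 * (p%:R ^+ 2 / (3 * k%:R + 2)).
  by rewrite /cz_boundary cE natrM; ring.
by apply: pdvdMl hq; pdvd_integral.
Qed.

(** * Assembly of the congruence modulo [p^2] *)

Lemma sum_linear_scaled_Domb (p : nat) : prime p -> p = 1 %[mod 3] ->
  pdvd p 2 (\sum_(n < p) (3 * n%:R + 1) * scaled_Domb n).
Proof.
move=> pp p3; have [m [i [pm ip im p7]]] := prime_1mod3_params _ pp p3.
have -> : \sum_(n < p) (3 * n%:R + 1) * scaled_Domb n
  = (3 * p%:R - 1) * (p%:R ^+ 1 * \sum_(k < p) cz_boundary p k / (3 * k%:R + 2)).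
  (* Terms with [k > n] vanish, so the inner range can be made independent of [n] and the sums
     exchanged. *)
  transitivity (\sum_(n < p) \sum_(k < p) (3 * n%:R + 1) * cz_term n k).
    by apply: eq_bigr => n _; rewrite -mulr_sumr sum_cz_term // scaled_DombE.
  rewrite exchange_big /= !mulr_sumr; apply: eq_bigr => k _.
  rewrite sum_linear_cz_term.
  transitivity ((3 * p%:R - 1) / (3 * k%:R + 2) * ((p%:R - k%:R) * cz_term p k)); first by ring.
  by rewrite cz_boundaryE ?prime_gt0 //; ring.
apply: pdvdMl; first by pdvd_integral.
apply: (@pdvdM p 1 1); first exact: pdvdX.
have mp : (m.+1 <= p)%N by lia.
rewrite -(big_mkord xpredT (fun k => cz_boundary p k / (3 * k%:R + 2))) (big_cat_nat _ mp) //=.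
apply: pdvdD.
  by rewrite big_mkord; apply: sum_cz_boundary_low im.
rewrite big_nat_cond; apply: pdvd_sum => k /andP [/andP [mk kp] _].
by apply: cz_boundary_high => //; lia.
Qed.

Theorem theorem4p2 (p : nat) (hp : prime p) (hp3 : p = 1 %[mod 3]) :
  rat_cong_mod_p2 p
    (\sum_(2 <= n < p)
        ((n.+1)%:R ^+ 2 / (n%:R * (n.-1)%:R)) * ((Domb n)%:R / 16%:R ^+ n) : rat)
    (3%:R / 2%:R).
Proof.
apply: pdvd_coprime_denq => //.
have [m [i [_ _ _ p7]]] := prime_1mod3_params _ hp hp3.
have hs := sum_linear_scaled_Domb _ hp hp3.
have c2 : coprime p 2 by rewrite prime_coprime //; apply/negP => /dvdn_leq; lia.
have hu n : pdvd p 0 (scaled_Domb n).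
  rewrite /scaled_Domb -natrX; apply: pdvd_divr => //; last exact: pdvd_natr.
  by apply: coprimeXr; exact: (@coprimeXr 4 p 2).
have cp : coprime p p.-1 by rewrite prime_coprime //; apply/negP => /dvdn_leq; lia.
have [N pN] : exists N, p = N.+2 by exists p.-2; lia.
(* Both boundary terms carry [p^2]; their cofactors are [p]-integral because 16 and [p - 1] are
   prime to [p]. *)
have -> : \sum_(2 <= n < p) ((n.+1)%:R ^+ 2 / (n%:R * (n.-1)%:R)) * ((Domb n)%:R / 16%:R ^+ n)
   - 3%:R / 2%:R
  = (\sum_(n < p) (3 * n%:R + 1) * scaled_Domb n) / 2%:R
    + (scaled_Domb N.+1 - 4 * p%:R * (scaled_Domb p / p.-1%:R)) * p%:R ^+ 2 :> rat.
  by rewrite pN weighted_sum_telescope /=; ring.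
apply: pdvdD; first exact: pdvd_divr.
apply: pdvdMl (pdvdX _ _).
have hN := hu N.+1; have hv := pdvd_divr _ _ _ _ hp cp (hu p).
by pdvd_integral.
Qed.
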